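(* Let $T=\{2143,2314,2341\}$. Then $$F_T(x)=\frac{1-6x+10x^2-3x^3+x^4}{(1-3x+x^2)(1-4x+2x^2)}.$$
   Context: $S_n(T)$ denotes the set of permutations $\pi$ of $[n]=\{1,\dots,n\}$ (one-line notation) that avoid every pattern $\tau\in T$, i.e. no subsequence of $\pi$ is order-isomorphic to $\tau$. $F_T(x)=\sum_{n\ge 0}|S_n(T)|x^n$, a formal power series, with $|S_0(T)|=1$. *)

(* Defs.v *)
From HB Require Import structures.
From mathcomp Require Import all_boot all_order all_algebra all_fingroup.
Set Implicit Arguments.
Unset Strict Implicit.
Unset Printing Implicit Defensive.
Import GRing.Theory.
Local Open Scope ring_scope.

Section Patterns.
Local Open Scope nat_scope.

(* The points and the values of a permutation in 'S_n are numbered from 0;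
   one-line notation lists the values shifted to 1, ..., n. *)
Definition one_line n (s : 'S_n) : seq nat := [seq (s i).+1 | i <- enum 'I_n].

Definition order_isomorphic (u v : seq nat) : bool :=
  (size u == size v) &&
  [forall i : 'I_(size u), forall j : 'I_(size u),
     (nth 0 u i < nth 0 u j) == (nth 0 v i < nth 0 v j)].

(* The subsequences of w are the [mask m w] with m of size [size w]. *)
Definition contains (w tau : seq nat) : bool :=
  [exists m : (size w).-tuple bool, order_isomorphic (mask m w) tau].

Lemma containsP (w tau : seq nat) :
  reflect (exists2 u, subseq u w & order_isomorphic u tau) (contains w tau).
Proof.
apply: (iffP existsP) => [[m om]|[u /subseqP[m sz_m ->] om]].
  by exists (mask m w) => //; apply: mask_subseq.
by exists (@Tuple _ _ m (introT eqP sz_m)).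
Qed.

Definition avoiders n (T : seq (seq nat)) : {set 'S_n} :=
  [set s : 'S_n | all (fun tau => ~~ contains (one_line s) tau) T].

End Patterns.

(* Formal power series, represented by their coefficient sequences. *)
Definition fps (R : Type) := nat -> R.

Section FormalPowerSeries.
Variable R : comUnitRingType.
Implicit Types (a b : fps R) (n : nat).

Definition fps_of_poly (p : {poly R}) : fps R := fun n => p`_n.

Definition fps_mul a b : fps R := fun n => \sum_(i < n.+1) a i * b (n - i)%N.

(* The coefficients b_0, ..., b_n of the inverse of a, from
   b_0 = a_0^-1 and b_n = - a_0^-1 * (a_1 b_(n-1) + ... + a_n b_0). *)
Fixpoint fps_inv_seq a n : seq R :=
  if n is m.+1 then
    let s := fps_inv_seq a m in
    rcons s (- (a 0%N)^-1 * \sum_(i < m.+1) a i.+1 * s`_(m - i))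
  else [:: (a 0%N)^-1].

Definition fps_inv a : fps R := fun n => (fps_inv_seq a n)`_n.

Definition fps_div a b : fps R := fps_mul a (fps_inv b).

Lemma size_fps_inv_seq a n : size (fps_inv_seq a n) = n.+1.
Proof. by elim: n => //= n IHn; rewrite size_rcons IHn. Qed.

Lemma nth_fps_inv_seq a n i : (i <= n)%N -> (fps_inv_seq a n)`_i = fps_inv a i.
Proof.
elim: n => [|n IHn]; first by rewrite leqn0 => /eqP->.
rewrite leq_eqVlt => /predU1P[-> //|lt_in].
by rewrite /= nth_rcons size_fps_inv_seq lt_in IHn.
Qed.

Lemma fps_mulV a : a 0%N \is a GRing.unit ->
  fps_mul a (fps_inv a) =1 fps_of_poly 1.
Proof.
move=> ua [|n]; rewrite /fps_mul /fps_of_poly coef1 big_ord_recl /=.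
  by rewrite big_ord0 addr0 divrr.
rewrite subn0 {1}/fps_inv /= nth_rcons size_fps_inv_seq ltnn eqxx.
rewrite mulNr mulrN mulrA divrr // mul1r addrC; apply/eqP; rewrite subr_eq0.
apply/eqP; apply: eq_bigr => i _.
by rewrite /= /bump subSS nth_fps_inv_seq // leq_subr.
Qed.

End FormalPowerSeries.

Definition avoiders_gf (T : seq (seq nat)) : fps rat :=
  fun n => #|avoiders n T|%:R.

(* Main.v *)
Require Import Defs.
From HB Require Import structures.
From mathcomp Require Import all_boot all_order all_algebra all_fingroup.
From mathcomp Require Import zify ring lra.
Import GRing.Theory.
Local Open Scope ring_scope.

(* A permutation k w of {0, ..., n} with 0 < k avoids T iff w does and the
   letters of w above k ("big") and below k ("small") satisfy: either w starts
   with its largest letter, which may be deleted; or w starts with a small letter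
   and, as soon as there are at least two big letters, w is a word u on the small
   letters, with u k avoiding T, followed by the big letters in increasing order.
   With f counting the avoiders and g those that end with their maximum, this
   gives c(n+1, k) = c(n, k) + g(k) for the number c(n, k) of avoiders w of
   length n such that k w is an avoider, and the same dichotomy gives
   g(n+1) = g(n) + g(1) + ... + g(n). Eliminating c yields linear recurrences for
   f and g with constant coefficients. *)

(** * Avoidance of the three patterns as a predicate on words *)

Section Words.
Local Open Scope nat_scope.

(* The comparisons with a larger letter are not strict, so that a may also be the
   first letter of [a :: map (bump a) w], with b, c and d taken from w. *)
Definition bad (a b c d : nat) : bool :=
  [|| [&& b < a, a <= d & d < c], [&& c < a, a <= b & b < d]
    | [&& d < a, a <= b & b < c]].

Fixpoint ok k s :=
  if s is x :: s' then pairwise (fun c d => ~~ bad k x c d) s' && ok k s'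
  else true.

Fixpoint good s := if s is x :: s' then ok x s' && good s' else true.

Lemma pairwise_subseqP (R : rel nat) s :
  reflect (forall a b, subseq [:: a; b] s -> R a b) (pairwise R s).
Proof.
apply: (iffP idP) => [pRs a b ab_s|].
  by have := subseq_pairwise ab_s pRs; rewrite /= !andbT.
elim: s => //= x s IHs Rs; apply/andP; split.
  by apply/allP => y ys; apply: Rs; rewrite eqxx sub1seq.
apply: IHs => a b ab_s; apply: Rs.
by have := subseq_trans ab_s (subseq_cons s x).
Qed.

Lemma okP k s :
  reflect (forall b c d, subseq [:: b; c; d] s -> ~~ bad k b c d) (ok k s).
Proof.
apply: (iffP idP).
  elim: s => [|x s IHs] //= /andP[/pairwise_subseqP pRs oks] b c d.
  by case: eqP => [-> /pRs|_ /(IHs oks)].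
elim: s => //= x s IHs Rs; apply/andP; split.
  by apply/pairwise_subseqP => c d cd_s; apply: Rs; rewrite eqxx.
apply: IHs => b c d bcd_s; apply: Rs.
by have := subseq_trans bcd_s (subseq_cons s x).
Qed.

Lemma goodP s :
  reflect (forall a b c d, subseq [:: a; b; c; d] s -> ~~ bad a b c d) (good s).
Proof.
apply: (iffP idP).
  elim: s => [|x s IHs] //= /andP[/okP pRs oks] a b c d.
  by case: eqP => [-> /pRs|_ /(IHs oks)].
elim: s => //= x s IHs Rs; apply/andP; split.
  by apply/okP => b c d bcd_s; apply: Rs; rewrite eqxx.
apply: IHs => a b c d abcd_s; apply: Rs.
by have := subseq_trans abcd_s (subseq_cons s x).
Qed.

(** [bump k] is strictly increasing and keeps each letter on its side of the threshold [k]. *)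
Lemma ok_bump k s : ok k (map (bump k) s) = ok k s.
Proof.
elim: s => //= x s ->; rewrite pairwise_map; congr (_ && _).
by apply: eq_pairwise => c d /=; rewrite /bad /bump; lia.
Qed.

Lemma bad_bump h a b c d :
  bad (bump h a) (bump h b) (bump h c) (bump h d) = bad a b c d.
Proof. by rewrite /bad /bump; lia. Qed.

Lemma good_bump h s : good (map (bump h) s) = good s.
Proof.
elim: s => //= x s ->; congr (_ && _); elim: s => //= y s ->.
rewrite pairwise_map; congr (_ && _).
by apply: eq_pairwise => c d /=; rewrite bad_bump.
Qed.

Lemma good_cons_bump k s : good (k :: map (bump k) s) = ok k s && good s.
Proof. by rewrite /= ok_bump good_bump. Qed.

(** * Permutations as words, counted by first letter or by increasing tail *)

Definition perms n := permutations (iota 0 n).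

Lemma mem_perms n w : (w \in perms n) = perm_eq w (iota 0 n).
Proof. by rewrite mem_permutations. Qed.

Lemma permsP n w :
  reflect [/\ uniq w, size w = n & forall x, x \in w = (x < n)] (w \in perms n).
Proof.
rewrite mem_perms; apply: (iffP idP) => [pw|[uw sw mw]].
  split; first by rewrite (perm_uniq pw) iota_uniq.
    by rewrite (perm_size pw) size_iota.
  by move=> x; rewrite (perm_mem pw) mem_iota.
by apply: uniq_perm => // [|x]; rewrite ?iota_uniq // mw mem_iota.
Qed.

Lemma perms_uniq n : uniq (perms n). Proof. exact: permutations_uniq. Qed.

Lemma count_perms_cons (Q : pred (seq nat)) n :
  count Q (perms n.+1) =
  \sum_(k < n.+1) count (fun w => Q ((k : nat) :: map (bump k) w)) (perms n).
Proof.
have E : perm_eq (perms n.+1)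
    (flatten [seq [seq k :: map (bump k) w | w <- perms n] | k <- iota 0 n.+1]).
  apply: uniq_perm; first exact: perms_uniq.
    apply: allpairs_uniq; rewrite ?iota_uniq ?perms_uniq //.
    move=> [k w] [k' w'] _ _ /= [<- /inj_map-> //]; exact: can_inj (bumpK k).
  move=> w; apply/idP/flatten_mapP => [|[k kn /mapP[v /permsP[uv sv mv] ->]]].
    case: w => [|k w] /permsP[]; first by [].
    move=> /andP[kw uw] [sw] mw.
    have kn : k < n.+1 by rewrite -mw inE eqxx.
    exists k; first by rewrite mem_iota add0n.
    have nk x : x \in w -> x != k by apply: contraTneq => ->.
    have wE : w = map (bump k) (map (unbump k) w).
      rewrite -map_comp map_id_in // => x xw /=.
      by rewrite unbumpKcond (negbTE (nk _ xw)).
    apply/mapP; exists (map (unbump k) w); last by rewrite -wE.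
    apply/permsP; split; [|by rewrite size_map|].
      by rewrite -(map_inj_uniq (can_inj (bumpK k))) -wE.
    move=> x; rewrite -(mem_map (can_inj (bumpK k))) -wE.
    have := mw (bump k x); rewrite inE; rewrite [bump k x == k]eq_sym.
    by rewrite (negbTE (neq_bump _ _)) /= => ->; rewrite /bump; move: kn; lia.
  rewrite mem_iota /= add0n in kn.
  apply/permsP; split => /=; last 1 first.
  - move=> x; rewrite inE; case: (x =P k) => [->|/eqP nxk] /=; first by rewrite kn.
    have -> : x = bump k (unbump k x) by rewrite unbumpKcond (negbTE nxk).
    rewrite (mem_map (can_inj (bumpK k))) mv; rewrite /bump /unbump; lia.
  - rewrite (map_inj_uniq (can_inj (bumpK k))) uv andbT.
    by apply/mapP => -[x _ /eqP]; rewrite (negbTE (neq_bump _ _)).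
  - by rewrite size_map sv.
rewrite (seq.permP E) count_flatten -map_comp sumnE big_map -/(index_iota 0 n.+1).
by rewrite big_mkord; apply: eq_bigr => i _ /=; rewrite count_map.
Qed.

Lemma count_perms_cat (Q : pred (seq nat)) n k : k <= n ->
  count (fun w => (w == take k w ++ iota k (n - k)) && Q (take k w)) (perms n)
  = count Q (perms k).
Proof.
move=> kn; rewrite -[RHS]size_filter -[LHS]size_filter.
rewrite -(size_map (cat^~ (iota k (n - k))) (filter _ (perms k))).
apply/perm_size/uniq_perm; first by rewrite filter_uniq ?perms_uniq.
  rewrite map_inj_in_uniq ?filter_uniq ?perms_uniq // => u v _ _ /(congr1 rev).
  by move/eqP; rewrite !rev_cat eqseq_cat // eqxx => /eqP/(inv_inj revK).
have iotaE : iota 0 n = iota 0 k ++ iota k (n - k) by rewrite -{1}(subnKC kn) iotaD.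
move=> w; rewrite mem_filter; apply/idP/mapP => [|[v]].
  case/andP=> /andP[/eqP wE Qw] wn; exists (take k w) => //.
  rewrite mem_filter Qw mem_perms -(perm_cat2r (iota k (n - k))) -wE -iotaE.
  by rewrite -mem_perms.
rewrite mem_filter => /andP[Qv vk] ->; have [_ sv _] := permsP _ _ vk.
by rewrite take_size_cat // eqxx Qv mem_perms iotaE perm_cat2r -mem_perms.
Qed.

(** * The shape of words that admit a given first letter *)

Lemma ok0 w : ok 0 w.
Proof. by apply/okP => b c d _; rewrite /bad; lia. Qed.

(** Each clause of [bad k] needs two distinct letters at least [k]; here only [k] itself can
    occur. *)
Lemma ok_large n k w : w \in perms n -> n <= k.+1 -> ok k w.
Proof.
move=> /permsP[_ _ mw] nk; apply/okP => b c d /mem_subseq bcd_w.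
have := bcd_w b; have := bcd_w c; have := bcd_w d.
by rewrite !inE !eqxx !orbT !mw /bad => /(_ isT) dn /(_ isT) cn /(_ isT) bn; lia.
Qed.

Lemma pairwise_mem2 (R : rel nat) s x y :
  pairwise R s -> x \in s -> y \in s -> x != y -> R x y || R y x.
Proof.
elim: s => //= z s IHs /andP[/allP Rz pRs]; rewrite !inE.
move=> /predU1P[->|xs] /predU1P[->|ys] nxy; first by rewrite eqxx in nxy.
- by rewrite Rz.
- by rewrite Rz ?orbT.
- exact: IHs.
Qed.

(** The relation encodes that the letters at least [k] come last and increase; [perms_split_iota] is
    the converse for permutations. *)
Lemma pairwise_cat_iota k v r : all (ltn^~ k) v ->
  pairwise (fun c d => (c < d) || (c < k) && (d < k)) (v ++ iota k r).
Proof.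
move=> vk; rewrite pairwise_cat; apply/and3P; split.
- apply/allrelP => x y xv; rewrite mem_iota => /andP[ky _].
  by have := allP vk x xv => /= xk; apply/orP; left; lia.
- apply/(pairwiseP 0) => i j; rewrite !inE => iv jv _.
  by have := allP vk _ (mem_nth 0 iv); have := allP vk _ (mem_nth 0 jv) => /= -> ->; rewrite orbT.
- have := iota_ltn_sorted k r; rewrite (sorted_pairwise ltn_trans).
  by apply: sub_pairwise => x y /= ->.
Qed.

(** In each clause of [bad k], a letter at least [k] precedes a smaller one. *)
Lemma ok_cat_iota k v r : all (ltn^~ k) v -> ok k (v ++ iota k r).
Proof.
move=> vk; apply/okP => b c d /subseq_pairwise/(_ (pairwise_cat_iota _ _ r vk)).
by rewrite /= /bad; lia.
Qed.

(** Of the three patterns, only the 4 of 2314 can lie in an increasing tail of largest letters, and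
    there [k] can replace it. *)
Lemma good_cat_iota k v r : 0 < r -> all (ltn^~ k) v ->
  good (v ++ iota k r) = good (rcons v k).
Proof.
move=> r0; have pw_iota s : pairwise ltn (iota k s).
  by rewrite -(sorted_pairwise ltn_trans) iota_ltn_sorted.
have ok_iota m s : ok m (iota k s).
  by apply/okP => b c d /subseq_pairwise/(_ (pw_iota s)); rewrite /= /bad; lia.
have good_iota s : good (iota k s).
  by apply/goodP => a b c d /subseq_pairwise/(_ (pw_iota s)); rewrite /= /bad; lia.
elim: v => /= [_|x v IHv /andP[xk vk]]; first by rewrite good_iota.
rewrite IHv //; congr (_ && _); elim: v vk {IHv} => /= [_|y v IHv /andP[yk vk]].
  by rewrite ok_iota.
rewrite IHv //; congr (_ && _); rewrite -cats1 !pairwise_cat; congr [&& _, _ & _].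
  apply/allrelP/allrelP => badF c d cv.
    rewrite inE => /eqP->; apply: badF => //; rewrite mem_iota; lia.
  rewrite mem_iota => /andP[kd _]; have := badF c k cv; rewrite inE eqxx.
  by have := allP vk c cv; rewrite /bad /=; move: xk yk kd; lia.
have kr : all (leq k) (iota k r) by apply/allP => c; rewrite mem_iota => /andP[].
rewrite /=; apply: (sub_in_pairwise (P := leq k)) kr (pw_iota r).
by move=> c d; rewrite -!topredE /= /bad; move: xk yk; lia.
Qed.

Lemma perms_split_iota n k w : w \in perms n -> k <= n ->
  pairwise (fun c d => (c < d) || (c < k) && (d < k)) w ->
  w = take k w ++ iota k (n - k).
Proof.
move=> /permsP[uw sw mw] kn pw.
have wE : w = filter (ltn^~ k) w ++ filter (leq k) w.
  elim: w pw {uw sw mw} => //= x s IHs /andP[/allP xs /IHs sE].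
  case: (ltnP x k) => kx; first by rewrite /= -sE.
  rewrite (@eq_in_filter _ (ltn^~ k) pred0) ?filter_pred0 /=; last first.
    by move=> y /xs /=; lia.
  by congr (_ :: _); apply/esym/all_filterP/allP => y /xs /=; lia.
have sk : size (filter (ltn^~ k) w) = k.
  rewrite -[RHS](size_iota 0); apply/perm_size/uniq_perm; rewrite ?filter_uniq ?iota_uniq //.
  by move=> x; rewrite mem_filter mw mem_iota /=; lia.
have bigE : filter (leq k) w = iota k (n - k).
  apply: (irr_sorted_eq ltn_trans ltnn); last 1 first.
  - by move=> x; rewrite mem_filter mw mem_iota; lia.
  - rewrite (sorted_pairwise ltn_trans).
    apply: (sub_in_pairwise (P := leq k)) (filter_all (leq k) w) (pairwise_filter (leq k) pw).
    by move=> x y; rewrite -!topredE /=; lia.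
  - exact: iota_ltn_sorted.
by rewrite {1}wE bigE {2}wE take_size_cat.
Qed.

(** The bounds on [k] supply one small letter and two big ones. Unless the maximum comes first,
    these build an occurrence led by [k] whenever the big letters do not form an increasing tail. *)
Lemma good_ok_split n k w : w \in perms n -> 0 < k -> k.+1 < n ->
  good w && ok k w && (head 0 w != n.-1) =
  (w == take k w ++ iota k (n - k)) && good (rcons (take k w) k).
Proof.
move=> wn k0 kn; have [uw sw mw] := permsP _ _ wn.
have kn' : k < n by exact: ltnW.
have small : w = take k w ++ iota k (n - k) -> all (ltn^~ k) (take k w).
  move=> wE; apply/allP => x xw /=; rewrite ltnNge; apply/negP => kx.
  have := uw; rewrite wE cat_uniq => /and3P[_ /hasPn nw _].
  have := nw x; rewrite mem_iota xw kx (subnKC (ltnW kn')).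
  by rewrite -mw (mem_take xw) => /(_ isT).
apply/idP/andP => [|[/eqP wE gw]]; last first.
  have vk := small wE; apply/andP; split; last first.
    have k0w : head 0 w \in take k w.
      case: (w) sw => [/= sw|x s _]; first by move: kn; lia.
      by case: (k) k0 => // k' _; exact: mem_head.
    by have := allP vk _ k0w => /=; move: kn; lia.
  by rewrite wE good_cat_iota // ?subn_gt0 // gw ok_cat_iota.
case/andP=> /andP[gw okw] hw.
suff wE : w = take k w ++ iota k (n - k).
  split; first by rewrite -wE.
  by rewrite -(@good_cat_iota k _ (n - k)) ?small -?wE // subn_gt0.
apply: perms_split_iota => //; first exact: ltnW.
case: w {small gw wn sw} uw mw okw hw => // y s /= /andP[ys us] mw /andP[pks oks] hw.
have yn : y < n by rewrite -mw mem_head.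
have ms x : x < n -> x != y -> x \in s by rewrite -mw inE => /predU1P[->|//]; rewrite eqxx.
(* If [y] were big, [0] and [n.-1] would both follow it and, in either order, complete [k y] to 2314
   or 2341. *)
have yk : y < k.
  rewrite ltnNge; apply/negP => ky.
  have := @pairwise_mem2 _ _ n.-1 0 pks; rewrite !ms; try by move: kn ky hw; lia.
  by rewrite /bad; move: kn ky yn hw; lia.
(* As [y] is small, a decreasing pair of big letters would complete [k y] to 2143. *)
have incr : pairwise (fun c d => ~~ (k <= d < c)) s.
  by apply: sub_pairwise pks => c d /=; rewrite /bad; move: yk; lia.
(* If a small [c] follows a big [b], a second big letter [b'] gives [k b' b c], [k b b' c] (both
   2341) or [k b c b'] (2314), according to its position. *)
have below b c : subseq [:: b; c] s -> k <= b -> ~~ (c < k).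
  move=> bc_s kb; apply/negP => ck.
  have [b' [kb' b'n bb']] : exists b', [/\ k <= b', b' < n & b' != b].
    by case: (b =P k) => [->|bk]; [exists k.+1|exists k]; split; lia.
  have b's : b' \in s by apply: ms => //; move: yk kb'; lia.
  have [s1 [s2 sE cs2]] : exists s1, exists2 s2, s = s1 ++ b :: s2 & c \in s2.
    elim: (s) bc_s => //= x s' IHs; case: eqP => [->|_ /IHs[s1 [s2 -> cs2]]].
      by rewrite sub1seq; exists [::], s'.
    by exists (x :: s1), s2.
  move: b's (oks) incr; rewrite sE mem_cat inE (negbTE bb') /=.
  case/orP=> [b's1 /okP okbs|b's2] incr.
    have /okbs : subseq [:: b'; b; c] (s1 ++ b :: s2).
      by rewrite (@cat_subseq _ [:: b']) ?sub1seq //= eqxx sub1seq.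
    have /pairwise_subseqP/(_ b' b) := incr.
    rewrite (@cat_subseq _ [:: b'] [:: b]) ?sub1seq ?mem_head // => /(_ isT).
    by rewrite /bad; move: bb' kb kb' ck; lia.
  move=> /pairwise_subseqP/(_ b b').
  rewrite (@subseq_trans _ (b :: s2)) ?suffix_subseq //=; last by rewrite eqxx sub1seq.
  have: ok k (b :: s2).
    apply/okP => p q r pqr; apply: (okP _ _ oks); rewrite sE.
    exact: subseq_trans pqr (suffix_subseq _ _).
  case/andP=> /(@pairwise_mem2 _ _ b' c)/(_ b's2 cs2) + _.
  by rewrite /bad; move: bb' kb kb' ck; lia.
apply/andP; split; last first.
  apply/pairwise_subseqP => a b ab_s; have := below a b ab_s.
  have /pairwise_subseqP/(_ a b ab_s) := incr.
  have := us; rewrite uniq_pairwise => /pairwise_subseqP/(_ a b ab_s) /=.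
  by case: (leqP k a) => ka; lia.
by apply/allP => x _ /=; move: yk; lia.
Qed.

(** * The counting sequences and their recurrences *)

Definition nb_good n := count good (perms n).
(* As n exceeds the letters of w, the words counted are the good permutations of
   length n + 1 that end with their maximum. *)
Definition nb_good_max n := count (fun w => good (rcons w n)) (perms n).
Definition nb_good_ok n k := count (fun w => good w && ok k w) (perms n).

Lemma nb_goodS n : nb_good n.+1 = \sum_(k < n.+1) nb_good_ok n k.
Proof.
rewrite /nb_good count_perms_cons; apply: eq_bigr => k _.
by apply: eq_count => w; rewrite good_cons_bump andbC.
Qed.

Lemma nb_good_ok0 n : nb_good_ok n 0 = nb_good n.
Proof. by apply: eq_count => w; rewrite ok0 andbT. Qed.

Lemma nb_good_ok_large n k : n <= k.+1 -> nb_good_ok n k = nb_good n.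
Proof.
by move=> nk; apply: eq_in_count => w wn; rewrite (@ok_large n k) ?andbT.
Qed.

Lemma nb_good_okS n k : 0 < k -> k < n ->
  nb_good_ok n.+1 k = nb_good_ok n k + nb_good_max k.
Proof.
move=> k0 kn; pose hd w := head 0 w == n.
rewrite /nb_good_ok; have /permPl/seq.permP E := perm_filterC hd (perms n.+1).
rewrite -E {E}.
rewrite count_cat !count_filter; congr (_ + _).
  (* A leading maximum [n] starts no occurrence; as second letter after [k] it is neither below [k]
     nor exceeded later, so it can be deleted. *)
  rewrite count_perms_cons big_ord_recr /= big1 ?add0n => [|i _]; last first.
    rewrite (@eq_count _ _ pred0) ?count_pred0 // => w.
    by rewrite /= /hd /= (ltn_eqF (ltn_ord i)) andbF.
  apply: eq_in_count => w wn.
  have [_ _ mw] := permsP _ _ wn.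
  have -> : map (bump n) w = w.
    by apply: map_id_in => x; rewrite mw /bump; lia.
  rewrite /= /hd /= eqxx andbT (@ok_large n n) //=; congr (_ && _).
  case: (ok k w); rewrite ?andbF // andbT.
  apply/(pairwiseP 0) => i j iw jw _; have := mem_nth 0 iw; have := mem_nth 0 jw.
  by rewrite !mw; move: (nth 0 w i) (nth 0 w j) => c d; rewrite /bad; lia.
rewrite /nb_good_max -(@count_perms_cat (fun w => good (rcons w k)) n.+1 k).
  by apply: eq_in_count => w wn /=; rewrite -good_ok_split.
exact: leqW (ltnW kn).
Qed.

(** Split by first letter: [0] starts no occurrence and can be removed, while [k.+1] contributes
    [nb_good_max k.+1]. *)
Lemma nb_good_maxS n :
  nb_good_max n.+1 = nb_good_max n + \sum_(k < n) nb_good_max k.+1.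
Proof.
rewrite /nb_good_max count_perms_cons big_ord_recl; congr (_ + _).
  apply: eq_count => w; rewrite /= -[n.+1]/(bump 0 n) -map_rcons.
  by rewrite -/(good (0 :: _)) good_cons_bump ok0.
apply: eq_bigr => -[k kn] _ /=.
have -> : bump 0 k = k.+1 by [].
transitivity (count (fun w => ok k.+1 (rcons w n) && good (rcons w n)) (perms n)).
  apply: eq_count => w; rewrite -[RHS](good_cons_bump k.+1 (rcons w n)) map_rcons.
  by rewrite [in RHS]/bump kn.
have rcons_perms m w : w \in perms m -> rcons w m \in perms m.+1.
  move=> /permsP[uw sw mw]; apply/permsP; split; rewrite ?size_rcons ?sw //.
    by rewrite rcons_uniq mw ltnn.
  by move=> x; rewrite mem_rcons inE mw; lia.
case: (ltngtP k.+1 n) kn => // [kn _|<- _].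
  rewrite -(@count_perms_cat (fun w => good (rcons w k.+1)) n k.+1) 1?ltnW //.
  apply: eq_in_count => w wn /=; have [uw sw mw] := permsP _ _ wn.
  have := good_ok_split _ k.+1 _ (rcons_perms n w wn) isT kn.
  (* The maximum is last and [w] is nonempty, so the exceptional case of the dichotomy is
     excluded. *)
  have -> : head 0 (rcons w n) != n.+1.-1.
    case: (w) sw mw => [/= sw _|x s _ mw] /=; first by move: kn; rewrite -sw.
    by have := mem_head x s; rewrite mw; lia.
  rewrite andbT [good _ && _]andbC => ->.
  have -> : iota k.+1 (n.+1 - k.+1) = rcons (iota k.+1 (n - k.+1)) n.
    by rewrite (subSn (ltnW kn)) -[(n - _).+1]addn1 iotaD (subnKC (ltnW kn)) cats1.
  rewrite -!cats1 takel_cat ?sw ?(ltnW kn) // catA eqseq_cat ?eqxx ?andbT //.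
  by rewrite size_cat size_iota size_takel ?sw ?(ltnW kn) // subnKC // ltnW.
(* When [k.+1 = n], the final letter is the only big one. *)
apply: eq_in_count => w wn; rewrite (@ok_large k.+2 k.+1) //.
exact: rcons_perms.
Qed.

(** Subtracting consecutive instances of [nb_good_maxS] cancels the sum. *)
Lemma nb_good_max_rec n :
  nb_good_max n.+2 + nb_good_max n = 3 * nb_good_max n.+1.
Proof.
have := nb_good_maxS n.+1; rewrite big_ord_recr /=; have := nb_good_maxS n.
set s := \sum_(k < n) _; lia.
Qed.

Lemma nb_good_rec n :
  nb_good n.+3 + 2 * nb_good n.+1 + nb_good_max n =
  4 * nb_good n.+2 + nb_good_max n.+1.
Proof.
(* The extreme first letters [0] and [m.+1] may precede every good word, whence the factor 2. *)
have step m : nb_good m.+2 = 2 * nb_good m.+1 + \sum_(k < m) nb_good_ok m.+1 k.+1.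
  rewrite nb_goodS big_ord_recl big_ord_recr /= nb_good_ok0 nb_good_ok_large //.
  rewrite (eq_bigr (fun k : 'I_m => nb_good_ok m.+1 k.+1)) //.
  lia.
have := step n; have := step n.+1; have := nb_good_maxS n.
(* The last term equals [nb_good n.+2]. The others obey [nb_good_okS], and their increments sum to
   [nb_good_max n.+1 - nb_good_max n]. *)
rewrite [in X in _ -> X -> _]big_ord_recr /= nb_good_ok_large //.
under [in X in _ -> X -> _]eq_bigr => k _ do rewrite nb_good_okS ?ltnS //.
rewrite big_split /=; lia.
Qed.

Lemma nb_good_small : [/\ nb_good 0 = 1, nb_good 1 = 1, nb_good 2 = 2,
  nb_good_max 0 = 1 & nb_good_max 1 = 1].
Proof. by vm_compute. Qed.

(** * From order isomorphism and ['S_n] to good words *)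

Lemma order_isomorphic4 a b c d p q r s :
  order_isomorphic [:: a; b; c; d] [:: p; q; r; s] =
  [&& (a < b) == (p < q), (b < a) == (q < p), (a < c) == (p < r),
      (c < a) == (r < p), (a < d) == (p < s), (d < a) == (s < p),
      (b < c) == (q < r), (c < b) == (r < q), (b < d) == (q < s),
      (d < b) == (s < q), (c < d) == (r < s) & (d < c) == (s < r)].
Proof.
apply/andP/idP => [[_ /forallP iso]|iso]; last first.
  move: iso; do 11![case/andP=> /eqP ?]; move=> /eqP ?; split=> //.
  apply/forallP => -[[|[|[|[|i]]]] // i4]; apply/forallP => -[[|[|[|[|j]]]] // j4];
  by rewrite /= ?ltnn ?eqxx //; apply/eqP.
have {}iso i j (i4 : i < 4) (j4 : j < 4) :
    (nth 0 [:: a; b; c; d] i < nth 0 [:: a; b; c; d] j) ==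
    (nth 0 [:: p; q; r; s] i < nth 0 [:: p; q; r; s] j).
  by have /forallP/(_ (Ordinal j4)) := iso (Ordinal i4).
rewrite (iso 0 1) // (iso 1 0) // (iso 0 2) // (iso 2 0) // (iso 0 3) //.
rewrite (iso 3 0) // (iso 1 2) // (iso 2 1) // (iso 1 3) // (iso 3 1) //.
by rewrite (iso 2 3) // (iso 3 2).
Qed.

(** On distinct letters the non-strict tests of [bad] become strict, and its clauses are 2143, 2314
    and 2341 in that order. *)
Lemma avoid_good w : uniq w ->
  all (fun tau => ~~ contains w tau)
    [:: [:: 2; 1; 4; 3]; [:: 2; 3; 1; 4]; [:: 2; 3; 4; 1]] = good w.
Proof.
move=> uw; apply/idP/goodP => [|gw].
  rewrite /= andbT => /and3P[n1 n2 n3] a b c d abcd_w.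
  have := subseq_uniq abcd_w uw; rewrite /= !inE => uabcd.
  apply/negP => /or3P bad_abcd.
  case: bad_abcd => bad_abcd; [apply: (negP n1) | apply: (negP n2) | apply: (negP n3)];
    apply/containsP; exists [:: a; b; c; d]; rewrite // order_isomorphic4;
    move: bad_abcd uabcd; lia.
have n4 p q r s : contains w [:: p; q; r; s] ->
    exists a b c d, subseq [:: a; b; c; d] w /\
      order_isomorphic [:: a; b; c; d] [:: p; q; r; s].
  case/containsP=> u uw' iso; have /andP[/eqP su _] := iso.
  by case: u su uw' iso => [|a [|b [|c [|d []]]]] //; exists a, b, c, d.
apply/allP => tau; rewrite !inE => tauT; apply/negP.
by case/or3P: tauT => /eqP-> /n4[a [b [c [d [/gw]]]]];
  rewrite order_isomorphic4 /bad; lia.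
Qed.

Lemma card_avoiders n :
  #|avoiders n [:: [:: 2; 1; 4; 3]; [:: 2; 3; 1; 4]; [:: 2; 3; 4; 1]]| =
  nb_good n.
Proof.
set T := (X in avoiders n X); pose word (s : 'S_n) := [seq (s i : nat) | i <- enum 'I_n].
have one_lineE s : one_line s = map (bump 0) (word s) by rewrite -map_comp.
have word_perms s : word s \in perms n.
  have us : uniq (word s).
    by rewrite map_inj_uniq ?enum_uniq // => i j /ord_inj/perm_inj.
  apply/permsP; split=> [//||x]; first by rewrite size_map size_enum_ord.
  apply/mapP/idP => [[i _ ->] //|xn].
  by exists (s^-1%g (Ordinal xn)); rewrite ?mem_enum // permKV.
have goodE s : s \in avoiders n T = good (word s).
  rewrite inE /T avoid_good; first by rewrite one_lineE good_bump.
  rewrite one_lineE (map_inj_uniq (can_inj (bumpK 0))).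
  by have [] := permsP _ _ (word_perms s).
rewrite cardE -(size_map word) /nb_good -size_filter.
apply/perm_size/uniq_perm; rewrite ?filter_uniq ?perms_uniq //.
  rewrite map_inj_uniq ?enum_uniq // => s t /eq_in_map st.
  by apply/permP => i; apply/ord_inj/st; rewrite mem_enum.
move=> w; rewrite mem_filter; apply/mapP/andP => [[s]|[gw wn]].
  by rewrite mem_enum goodE => gs ->.
have [uw sw mw] := permsP _ _ wn.
(* Surjectivity: [w] comes from the permutation sending [i] to its [i]-th letter. *)
have wlt (i : 'I_n) : nth 0 w i < n by rewrite -mw mem_nth ?sw.
have winj : injective (fun i : 'I_n => Ordinal (wlt i)).
  move=> i j [/eqP]; rewrite nth_uniq ?sw // => /eqP; exact: ord_inj.
have wE : w = word (perm winj).
  apply: (@eq_from_nth _ 0) => [|i]; first by rewrite size_map size_enum_ord.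
  rewrite sw => ilt.
  rewrite (nth_map (Ordinal ilt)) ?size_enum_ord // permE /=.
  by rewrite nth_enum_ord.
by exists (perm winj); rewrite // mem_enum goodE -wE.
Qed.

End Words.

(** * Identifying a quotient of formal power series *)

Section FPS.
Variable R : comUnitRingType.
Implicit Types a b c : fps R.

(** Truncation lets associativity be inherited from polynomials. *)
Lemma fps_mul_trunc a b n i : (i <= n)%N ->
  fps_mul a b i = ((\poly_(j < n.+1) a j) * (\poly_(j < n.+1) b j))`_i.
Proof.
move=> le_in; rewrite coefM; apply: eq_bigr => j _; rewrite !coef_poly.
by rewrite !ltnS (leq_trans (leq_ord j)) // (leq_trans (leq_subr _ _)).
Qed.

Lemma fps_mulA a b c : fps_mul a (fps_mul b c) =1 fps_mul (fps_mul a b) c.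
Proof.
move=> n; set T := fun a : fps R => \poly_(j < n.+1) a j.
transitivity ((T a * (T b * T c))`_n).
  rewrite coefM; apply: eq_bigr => i _.
  by rewrite (fps_mul_trunc _ _ n) ?leq_subr // coef_poly ltn_ord.
rewrite mulrA coefM; apply: eq_bigr => i _.
by rewrite (fps_mul_trunc _ _ n) ?leq_ord // coef_poly ltnS leq_subr.
Qed.

Lemma fps_mulr1 a : fps_mul a (fps_of_poly 1) =1 a.
Proof.
move=> n; rewrite /fps_mul big_ord_recr /= big1 ?add0r => [|i _].
  by rewrite subnn /fps_of_poly coef1 mulr1.
by rewrite /fps_of_poly coef1 subn_eq0 leqNgt ltn_ord mulr0.
Qed.

Lemma eq_fps_mul a a' b b' : a =1 a' -> b =1 b' -> fps_mul a b =1 fps_mul a' b'.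
Proof. by move=> aE bE n; apply: eq_bigr => i _; rewrite aE bE. Qed.

Lemma fps_div_eq a b c : b 0%N \is a GRing.unit ->
  fps_mul c b =1 a -> c =1 fps_div a b.
Proof.
move=> ub cbE n; rewrite /fps_div -(eq_fps_mul _ _ _ _ cbE (frefl _)) -fps_mulA.
by rewrite (eq_fps_mul _ _ _ _ (frefl c) (fps_mulV ub)) fps_mulr1.
Qed.

End FPS.

Theorem theorem20 :
  avoiders_gf [:: [:: 2; 1; 4; 3]; [:: 2; 3; 1; 4]; [:: 2; 3; 4; 1]]%N =1
  fps_div
    (fps_of_poly (1 - 6 *: 'X + 10 *: 'X^2 - 3 *: 'X^3 + 'X^4 : {poly rat}))
    (fps_of_poly ((1 - 3 *: 'X + 'X^2) * (1 - 4 *: 'X + 2 *: 'X^2) : {poly rat})).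
Proof.
set f := avoiders_gf _; pose g n : rat := (nb_good_max n)%:R.
have fE n : f n = (nb_good n)%:R by rewrite /f /avoiders_gf card_avoiders.
have frec n : f n.+3 + 2 * f n.+1 + g n = 4 * f n.+2 + g n.+1.
  by rewrite !fE -!natrM -!natrD nb_good_rec.
have grec n : g n.+2 + g n = 3 * g n.+1.
  by rewrite -natrM -natrD nb_good_max_rec.
have [f0 f1 f2 [g0 g1]] : [/\ f 0%N = 1, f 1%N = 1, f 2%N = 2 & g 0%N = 1 /\ g 1%N = 1].
  by rewrite !fE /g; have [-> -> -> -> ->] := nb_good_small.
have Poly_cons c s : Poly (c :: s) = Poly s * 'X + c%:P :> {poly rat}.
  exact: cons_poly_def.
have Poly_nil : Poly [::] = 0 :> {poly rat} by [].
set num := _ + _ : {poly rat}; set den := _ * _ : {poly rat}.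
have numE : num = Poly [:: 1; -6; 10; -3; 1].
  by rewrite /num !Poly_cons Poly_nil -!mul_polyC; ring.
have denE : den = Poly [:: 1; -7; 15; -10; 2] :> {poly rat}.
  rewrite /den !Poly_cons Poly_nil -!mul_polyC; ring.
have dencoef i : den`_i = nth 0 [:: 1; -7; 15; -10; 2] i by rewrite denE coef_Poly.
apply: fps_div_eq; first by rewrite /fps_of_poly dencoef.
move=> n; rewrite /fps_of_poly numE coef_Poly /fps_mul.
under eq_bigr => i _ do rewrite dencoef.
case: n => [|[|[|[|n]]]].
- by rewrite !big_ord_recr big_ord0 /= f0; lra.
- by rewrite !big_ord_recr big_ord0 /= f0 f1; lra.
- by rewrite !big_ord_recr big_ord0 /= f0 f1 f2; lra.
- by rewrite !big_ord_recr big_ord0 /= f0 f1 f2; have := frec 0%N; rewrite f1 f2 g0 g1; lra.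
(* The denominator has degree 4, so only the last five terms of the convolution survive. *)
rewrite 5!big_ord_recr /= big1 => [|i _]; last first.
  rewrite nth_default ?mulr0 //=; have := ltn_ord i; lia.
have -> : (n.+4 - n = 4)%N by lia.
have -> : (n.+4 - n.+1 = 3)%N by lia.
have -> : (n.+4 - n.+2 = 2)%N by lia.
have -> : (n.+4 - n.+3 = 1)%N by lia.
rewrite subnn /=.
(* The coefficient of [x^4] is the last one where the numerator is nonzero. *)
case: n => [|n] /=.
  have := frec 0%N; have := frec 1%N; have := grec 0%N; rewrite f0 f1 f2 g0 g1; lra.
rewrite nth_nil.
(* Combining three instances of [frec] with weights 1, -3, 1 eliminates [g] through [grec]; this
   accounts for the factor [1 - 3x + x^2], and [frec] itself for [1 - 4x + 2x^2]. *)
have := frec n; have := frec n.+1; have := frec n.+2.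
have := grec n; have := grec n.+1; lra.
Qed.
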